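(* Let $(H,\mathcal B)$ be a dualizable ARN-hypergroup. Then $(H,\mathcal B)$ is nilpotent if and only if its dual $\widehat{(H,\mathcal B)}$ is nilpotent. Moreover, in this case they have the same nilpotency class.
   Context: ARN-hypergroup (abelian real non-negative hypergroup) $(H,\mathcal B)$: a finite-dimensional commutative unital associative $\mathbb C$-algebra $H$ with a $\mathbb C$-basis $\mathcal B=\{x_1=1,\dots,x_m\}$, $x_ix_j=\sum_kN_{i,j}^kx_k$ with $N_{i,j}^k\in\mathbb R_{\ge0}$, and an involution $i\mapsto i^*$ of $\{1,\dots,m\}$ such that $N_{i,i^*}^1>0$ and $N_{i,j}^1=0$ if $j\ne i^*$. Standing assumption: $x_i\mapsto x_{i^*}$ extends to an anti-involution of $H$, i.e. $N_{i,j}^k=N_{j^*,i^*}^{k^*}$. Put $h_i:=1/N_{i,i^*}^1$. $\mathrm{FPdim}:H\to\mathbb C$ is the unique algebra morphism with positive values on $\mathcal B$; $d_i:=\mathrm{FPdim}(x_i)$. $\widehat{\mathcal B}=\{\mu_1=\mathrm{FPdim},\mu_2,\dots,\mu_m\}$ is the set of all unital algebra morphisms $H\to\mathbb C$, a basis of $H^*$. The dual hypergroup $\widehat{(H,\mathcal B)}$ is $H^*$ with basis $\widehat{\mathcal B}$, product $(f\star g)(x_i/d_i)=f(x_i/d_i)g(x_i/d_i)$ for all $i$, unit $\mu_1$, involution $\mu_{j^\#}(x_i)=\mu_j(x_{i^*})$. An ARN-hypergroup is dualizable if its dual is also an ARN-hypergroup, i.e. all structure constants of $\star$ in the basis $\widehat{\mathcal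 B}$ are $\ge0$. A sub-hypergroup is the linear span of a subset of the basis that is closed under the involution and whose span is a subalgebra (it is again an ARN-hypergroup with this subset as basis). Adjoint sub-hypergroup: $H_{ad}$ is the sub-hypergroup whose basis consists of all standard elements occurring with non-zero coefficient in some power ($n\ge1$) of $\sum_ih_ix_ix_{i^*}$. Set $H^{(0)}=H$, $H^{(n)}=(H^{(n-1)})_{ad}$ for $n\ge1$. $(H,\mathcal B)$ is nilpotent if $H^{(n)}=\mathbb C$ (the span of the unit) for some $n$; the smallest such $n$ is the nilpotency class. The same definitions are applied to the dual. *)

(* Defs.v *)
From HB Require Import structures.
From mathcomp Require Import all_boot all_order all_algebra.
From mathcomp Require Import complex.
From mathcomp Require Import boolp classical_sets reals.

Set Implicit Arguments.
Unset Strict Implicit.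
Unset Printing Implicit Defensive.

Import Order.TTheory GRing.Theory Num.Theory.
Local Open Scope ring_scope.

(* Raw data of a based algebra with involution: the axioms are in
   [ARN_hypergroup] below, so that the dual can be formed as data before one
   asks whether it is an ARN-hypergroup.  The basis has [hg_rk.+1] elements and
   the one of index [ord0] plays the role of the unit x_1 = 1. *)
Record hypergroup_data (C : numClosedFieldType) := HypergroupData {
  hg_space :> vectType C;
  hg_mul : hg_space -> hg_space -> hg_space;
  hg_rk : nat;
  hg_basis : hg_rk.+1.-tuple hg_space;
  hg_inv : 'I_hg_rk.+1 -> 'I_hg_rk.+1 }.

Section Hypergroup.
Variables (C : numClosedFieldType) (H : hypergroup_data C).
Local Notation I := 'I_(hg_rk H).+1.
Implicit Types (i j k : I) (u v w : H) (S : {set I}).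

Definition hg_elt i : H := tnth (hg_basis H) i.

Definition hg_one : H := hg_elt ord0.

Definition hg_coef k v : C := coord (hg_basis H) k v.

Definition hg_N i j k : C := hg_coef k (hg_mul (hg_elt i) (hg_elt j)).

Definition hg_pow v (n : nat) : H := iter n (hg_mul v) hg_one.

(* With commutativity, linearity on the left gives bilinearity. *)
Definition comm_algebra : Prop :=
  [/\ forall (a : C) u v w,
        hg_mul (a *: u + v) w = a *: hg_mul u w + hg_mul v w,
      associative (@hg_mul C H),
      commutative (@hg_mul C H)
    & left_id hg_one (@hg_mul C H)].

(* In a [numClosedFieldType], [0 <= z] means that z is real and nonnegative. *)
Record ARN_hypergroup : Prop := ARNHypergroup {
  ARN_algebra : comm_algebra;
  ARN_basis : basis_of fullv (hg_basis H);
  ARN_ge0 : forall i j k, 0 <= hg_N i j k;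
  ARN_involutive : involutive (@hg_inv C H);
  ARN_inv_gt0 : forall i, 0 < hg_N i (hg_inv i) ord0;
  ARN_inv_eq0 : forall i j, j != hg_inv i -> hg_N i j ord0 = 0;
  ARN_antimorph : forall i j k,
    hg_N i j k = hg_N (hg_inv j) (hg_inv i) (hg_inv k) }.

Definition hg_h i : C := (hg_N i (hg_inv i) ord0)^-1.

(* A sub-hypergroup is represented by the set S of indices of its basis; its
   structure constants, hence also the h_i and the coefficients of powers, are
   those of H. *)
Definition adjoint_elt S : H :=
  \sum_(i in S) hg_h i *: hg_mul (hg_elt i) (hg_elt (hg_inv i)).

Definition adjoint S : {set I} :=
  [set k | `[< exists2 n : nat, (0 < n)%N
                 & hg_coef k (hg_pow (adjoint_elt S) n) != 0 >]]%SET.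

Definition adjoint_series (n : nat) : {set I} := iter n adjoint [set: I]%SET.

Definition nilpotent_hypergroup : Prop :=
  exists n, adjoint_series n = [set ord0]%SET.

Definition is_nilpotency_class (c : nat) : Prop :=
  adjoint_series c = [set ord0]%SET /\
  forall n, adjoint_series n = [set ord0]%SET -> (c <= n)%N.

Definition hg_dual_space : vectType C := 'Hom(H, C^o).

Definition algebra_morphism (f : hg_dual_space) : Prop :=
  f hg_one = 1 /\ forall u v, f (hg_mul u v) = f u * f v.

Definition is_FPdim (f : hg_dual_space) : Prop :=
  algebra_morphism f /\ forall i, 0 < f (hg_elt i).

(* Every ARN-hypergroup has exactly one such f; 0 is a junk value. *)
Definition FPdim : hg_dual_space := xget 0 [set f | is_FPdim f]%classic.

Definition hg_d i : C := FPdim (hg_elt i).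

(* The linear form whose value at each x_i / d_i is
   f (x_i / d_i) * g (x_i / d_i); see [dual_mulE]. *)
Definition dual_mul (f g : hg_dual_space) : hg_dual_space :=
  linfun (fun v : H => \sum_i hg_coef i v * hg_d i *
    (f ((hg_d i)^-1 *: hg_elt i) * g ((hg_d i)^-1 *: hg_elt i)) : C^o).

Definition dual_basis_spec (mu : (hg_rk H).+1.-tuple hg_dual_space) : Prop :=
  [/\ tnth mu ord0 = FPdim, uniq mu
    & forall f, f \in mu <-> algebra_morphism f].

(* Some enumeration of the algebra morphisms, starting with FPdim. *)
Definition dual_basis : (hg_rk H).+1.-tuple hg_dual_space :=
  xget [tuple 0 | _ < (hg_rk H).+1] [set mu | dual_basis_spec mu]%classic.

(* The index j# such that mu_(j#) (x_i) = mu_j (x_(i* )) for all i. *)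
Definition dual_inv j : I :=
  odflt j [pick k | [forall i, tnth dual_basis k (hg_elt i) ==
                               tnth dual_basis j (hg_elt (hg_inv i))]].

Definition dual_hypergroup : hypergroup_data C :=
  HypergroupData dual_mul dual_basis dual_inv.

Lemma dual_mulE (f g : hg_dual_space) i :
  basis_of fullv (hg_basis H) -> hg_d i != 0 ->
  dual_mul f g ((hg_d i)^-1 *: hg_elt i) =
  f ((hg_d i)^-1 *: hg_elt i) * g ((hg_d i)^-1 *: hg_elt i).
Proof.
move=> /basis_free freeB di0; rewrite /dual_mul.
set F : H -> C^o := (X in linfun X).
have linF : linear F.
  move=> a u v; rewrite /F scaler_sumr -big_split; apply: eq_bigr => j _ /=.
  by rewrite /hg_coef linearP !mulrDl /GRing.scale /= !mulrA.
pose L := GRing.isLinear.Build C H C^o _ F linF.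
pose FL : {linear H -> C^o} := HB.pack F L.
have coordE j (a : C) : hg_coef j (a *: hg_elt i) = a * (i == j)%:R.
  rewrite /hg_coef /hg_elt (tnth_nth 0) linearZ; congr (_ * _).
  exact: coord_free.
rewrite -[F]/(FL : H -> C^o) lfunE /= /F (bigD1 i) //= big1 ?addr0 => [|j ji].
  by rewrite coordE eqxx mulr1 mulVf ?mul1r.
by rewrite coordE eq_sym (negbTE ji) mulr0 !mul0r.
Qed.

End Hypergroup.

Definition dualizable (C : numClosedFieldType) (H : hypergroup_data C) : Prop :=
  ARN_hypergroup (dual_hypergroup H).

(* Main.v *)
Require Import Defs.
From mathcomp Require Import all_boot all_order all_algebra.
From mathcomp Require Import complex ring.
From mathcomp Require Import boolp reals.

(* For a set S of basis elements of H, let perp S be the set of characters mu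
   with mu(x_i) = d_i for all i in S.  If a nonnegative combination of numbers
   z_k with |z_k| <= d_k equals the same combination of the d_k, then z_k = d_k
   wherever the coefficient is nonzero.  Applied to the products x_i x_(i^* ) in
   H and mu_j mu_(j#) in the dual, this shows that
   adjoint T \subset perp S if and only if T \subset perp (adjoint S).
   Iterating this from the full sets S and T, the n-th terms of the two adjoint
   series are trivial simultaneously. *)

Set Implicit Arguments.
Unset Strict Implicit.
Unset Printing Implicit Defensive.

Import Order.TTheory GRing.Theory Num.Theory.
Local Open Scope ring_scope.

(** * Products expanded in the basis *)

Section ARN.
Variables (C : numClosedFieldType) (H : hypergroup_data C).
Hypothesis ARN_H : ARN_hypergroup H.
Local Notation I := 'I_(hg_rk H).+1.
Local Notation "u ** v" := (@hg_mul C H u v) (at level 40, left associativity).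
Implicit Types (i j k : I) (u v w : H) (S T : {set I}).

Lemma hg_decomp v : v = \sum_i hg_coef i v *: hg_elt i.
Proof.
rewrite {1}(coord_basis (ARN_basis ARN_H) (memvf v)).
by apply: eq_bigr => i _; rewrite /hg_elt (tnth_nth 0).
Qed.

Lemma hg_coef_elt k i : hg_coef k (hg_elt i) = (i == k)%:R.
Proof.
rewrite /hg_coef /hg_elt (tnth_nth 0) coord_free ?(basis_free (ARN_basis ARN_H)) //.
Qed.

Lemma hg_coef_sum J (r : seq J) (P : pred J) (F : J -> H) k :
  hg_coef k (\sum_(a <- r | P a) F a) = \sum_(a <- r | P a) hg_coef k (F a).
Proof. exact: linear_sum. Qed.

Lemma hg_mul_lin (a : C) u v w : (a *: u + v) ** w = a *: (u ** w) + v ** w.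
Proof. by case: (ARN_algebra ARN_H). Qed.

Lemma hg_mulC : commutative (@hg_mul C H).
Proof. by case: (ARN_algebra ARN_H). Qed.

Lemma hg_mul1 : right_id (hg_one H) (@hg_mul C H).
Proof. by move=> v; rewrite hg_mulC; case: (ARN_algebra ARN_H). Qed.

Lemma hg_mul_suml (r : seq I) (c : I -> C) (F : I -> H) w :
  (\sum_(i <- r) c i *: F i) ** w = \sum_(i <- r) c i *: (F i ** w).
Proof.
elim: r => [|i r IHr]; last by rewrite !big_cons hg_mul_lin IHr.
(* The empty sum requires 0 ** w = 0; scalar -1 with u = v = 0 yields it as -(0 ** w) + 0 ** w. *)
rewrite !big_nil; have := hg_mul_lin (-1) 0 0 w.
by rewrite scaler0 addr0 scaleN1r addNr.
Qed.

Lemma hg_mulE u v : u ** v =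
  \sum_i \sum_j hg_coef i u *: (hg_coef j v *: (hg_elt i ** hg_elt j)).
Proof.
rewrite {1}(hg_decomp u) hg_mul_suml; apply: eq_bigr => i _.
by rewrite -scaler_sumr hg_mulC {1}(hg_decomp v) hg_mul_suml; congr (_ *: _);
  apply: eq_bigr => j _; rewrite hg_mulC.
Qed.

Lemma hg_coef_mul k u v : hg_coef k (u ** v) =
  \sum_i \sum_j hg_coef i u * (hg_coef j v * hg_N i j k).
Proof.
rewrite hg_mulE hg_coef_sum; apply: eq_bigr => i _; rewrite hg_coef_sum.
by apply: eq_bigr => j _; rewrite /hg_N /hg_coef !linearZ.
Qed.

(** * Adjoint sets *)

Lemma hg_coef_adjoint_elt k S : hg_coef k (adjoint_elt S) =
  \sum_(i in S) hg_h i * hg_N i (hg_inv i) k.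
Proof. by rewrite hg_coef_sum; apply: eq_bigr => i _; rewrite /hg_coef linearZ. Qed.

Lemma hg_h_gt0 i : 0 < hg_h i.
Proof. by rewrite invr_gt0 (ARN_inv_gt0 ARN_H). Qed.

Lemma adjoint_term_ge0 i k : 0 <= hg_h i * hg_N i (hg_inv i) k.
Proof. by rewrite mulr_ge0 ?(ARN_ge0 ARN_H) ?ltW ?hg_h_gt0. Qed.

(** The first power suffices: all terms of [adjoint_elt S] have nonnegative coefficients, so nothing
    cancels. *)
Lemma adjoint_N i k S : i \in S -> hg_N i (hg_inv i) k != 0 -> k \in adjoint S.
Proof.
move=> iS Nk; rewrite inE; apply/asboolP; exists 1%N => //=.
rewrite hg_mul1 hg_coef_adjoint_elt psumr_neq0 => [|j _]; last exact: adjoint_term_ge0.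
apply/hasP; exists i; rewrite ?mem_index_enum //= iS lt0r adjoint_term_ge0 andbT.
by rewrite mulf_neq0 // gt_eqF ?hg_h_gt0.
Qed.

Lemma adjoint_ord0 S : ord0 \in S -> ord0 \in adjoint S.
Proof. by move=> S0; apply: (adjoint_N S0); rewrite gt_eqF ?(ARN_inv_gt0 ARN_H). Qed.

Lemma adjoint_series_ord0 n : ord0 \in adjoint_series H n.
Proof. by elim: n => [|n IHn]; [rewrite inE | apply: adjoint_ord0]. Qed.

Lemma adjoint_series_eq1 n :
  (adjoint_series H n == [set ord0]%SET) = (adjoint_series H n \subset [set ord0]%SET).
Proof. by rewrite eqEsubset sub1set adjoint_series_ord0 andbT. Qed.

(** That is, the span of [T] is a unital subalgebra. *)
Definition mul_closed T :=
  ord0 \in T /\ forall i j k, i \in T -> j \in T -> hg_N i j k != 0 -> k \in T.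

(** This removes the powers from [adjoint]: once [adjoint_elt S] is supported in the closed set [T],
    so are all its powers. *)
Lemma adjoint_subP S T : mul_closed T ->
  (forall i k, i \in S -> hg_N i (hg_inv i) k != 0 -> k \in T) <-> adjoint S \subset T.
Proof.
move=> [T0 TM]; split=> [ST | /subsetP ST i k iS Nk]; last exact: ST (adjoint_N iS Nk).
have aT k : k \notin T -> hg_coef k (adjoint_elt S) = 0.
  move=> kT; rewrite hg_coef_adjoint_elt big1 // => i iS.
  have [->|/(ST _ _ iS) kT'] := eqVneq (hg_N i (hg_inv i) k) 0; first by rewrite mulr0.
  by rewrite kT' in kT.
apply/subsetP => k; rewrite inE => /asboolP [n _]; apply: contraNT => kT; apply/eqP.
elim: n k kT => [|n IHn] k kT /=.
  by rewrite hg_coef_elt; have [k0|//] := eqVneq ord0 k; rewrite -k0 T0 in kT.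
rewrite hg_coef_mul big1 // => i _; rewrite big1 // => j _.
have [iT|/aT->] := boolP (i \in T); last by rewrite mul0r.
have [jT|/IHn->] := boolP (j \in T); last by rewrite mul0r mulr0.
have [->|/(TM _ _ _ iT jT) kT'] := eqVneq (hg_N i j k) 0; first by rewrite !mulr0.
by rewrite kT' in kT.
Qed.

(** * Characters and the involution *)

Lemma morph_N (f : hg_dual_space H) i j : algebra_morphism f ->
  f (hg_elt i) * f (hg_elt j) = \sum_k hg_N i j k * f (hg_elt k).
Proof.
move=> [_ fM]; rewrite -fM {1}(hg_decomp (_ ** _)) linear_sum.
by apply: eq_bigr => k _; rewrite linearZ.
Qed.

Definition coord_form i : hg_dual_space H := linfun (coord (hg_basis H) i : H -> C^o).

Lemma coord_form_elt i k : coord_form i (hg_elt k) = (k == i)%:R.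
Proof. by rewrite lfunE; exact: hg_coef_elt. Qed.

(** For a character mu_j of the dual basis, this is the candidate for mu_(j#). *)
Definition inv_form (f : hg_dual_space H) : hg_dual_space H :=
  \sum_i f (hg_elt (hg_inv i)) *: coord_form i.

Lemma inv_form_elt f i : inv_form f (hg_elt i) = f (hg_elt (hg_inv i)).
Proof.
rewrite sum_lfunE (bigD1 i) //= big1 ?addr0 => [|j ji].
  by rewrite scale_lfunE coord_form_elt eqxx [LHS]mulr1.
by rewrite scale_lfunE coord_form_elt eq_sym (negPf ji) scaler0.
Qed.

Lemma hg_inv0 : hg_inv ord0 = ord0 :> I.
Proof.
apply/eqP; rewrite eq_sym; apply: contraT => n0.
(* If the unit were not self-dual, the coefficient of 1 in 1 * 1 would vanish. *)
have := ARN_inv_eq0 ARN_H n0; rewrite /hg_N -/(hg_one H) hg_mul1 hg_coef_elt eqxx.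
by move/eqP; rewrite oner_eq0.
Qed.

Lemma morph_mulP (f : hg_dual_space H) : f (hg_one H) = 1 ->
  (forall i j, f (hg_elt i) * f (hg_elt j) = \sum_k hg_N i j k * f (hg_elt k)) ->
  algebra_morphism f.
Proof.
move=> f1 fN; split=> // u v.
rewrite hg_mulE {2}(hg_decomp u) {2}(hg_decomp v) !linear_sum mulr_suml.
apply: eq_bigr => i _; rewrite linear_sum mulr_sumr; apply: eq_bigr => j _.
rewrite !linearZ /= scalerA mulrACA fN {1}(hg_decomp (_ ** _)) linear_sum.
congr (_ * _).
by apply: eq_bigr => k _; rewrite linearZ.
Qed.

(** The involution reverses products, which is harmless because values in [C] commute. *)
Lemma inv_form_morph f : algebra_morphism f -> algebra_morphism (inv_form f).
Proof.
move=> fM; apply: morph_mulP => [|i j].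
  by rewrite inv_form_elt hg_inv0; case: fM.
rewrite !inv_form_elt mulrC (morph_N _ _ fM) (reindex_inj (inv_inj (ARN_involutive ARN_H))).
by apply: eq_bigr => k _ /=; rewrite inv_form_elt -(ARN_antimorph ARN_H).
Qed.

(** * Characters bounded by the Frobenius-Perron dimension *)

Section FP.
Variable fp : hg_dual_space H.
Hypothesis FP_fp : is_FPdim fp.
Local Notation d i := (fp (hg_elt i)).

Lemma d_gt0 i : 0 < d i. Proof. exact: FP_fp.2. Qed.

(* Evaluate chi(x_i) chi(x_j) at an index j maximizing |chi(x_j)| / d_j. *)
Lemma morph_le_d (chi : hg_dual_space H) i :
  algebra_morphism chi -> `|chi (hg_elt i)| <= d i.
Proof.
move=> chiM; pose r j := `|chi (hg_elt j)| / d j.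
have rR j : r j \is Num.real.
  by rewrite ger0_real // divr_ge0 ?normr_ge0 // ltW ?d_gt0.
have [j _ jmax] : exists2 j, true & forall k, r k <= r j.
  have [j _ jm] := (@real_arg_maxP C I ord0 predT r isT (fun k _ => rR k)).
  by exists j => // k; apply: jm.
have r0 : 0 < r ord0 by rewrite divr_gt0 ?d_gt0 // chiM.1 normr1 ltr01.
have chij : 0 < `|chi (hg_elt j)|.
  by have := lt_le_trans r0 (jmax ord0); rewrite pmulr_lgt0 // invr_gt0 d_gt0.
rewrite -(ler_pM2r chij) -normrM (morph_N _ _ chiM) (le_trans (ler_norm_sum _ _ _)) //.
have -> : d i * `|chi (hg_elt j)| = \sum_k r j * (hg_N i j k * d k).
  by rewrite -mulr_sumr -(morph_N _ _ FP_fp.1) /r mulrCA divfK // gt_eqF ?d_gt0.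
apply: ler_sum => k _; rewrite normrM ger0_norm ?(ARN_ge0 ARN_H) // mulrCA.
by rewrite ler_wpM2l ?(ARN_ge0 ARN_H) // -ler_pdivrMr ?d_gt0 //; apply: jmax.
Qed.

(** The character [inv_form fp] obeys the bound [morph_le_d]; using it at i and at its dual index
    gives both inequalities. *)
Lemma d_inv i : d (hg_inv i) = d i.
Proof.
have le k : d (hg_inv k) <= d k.
  have := morph_le_d k (inv_form_morph FP_fp.1).
  by rewrite inv_form_elt gtr0_norm ?d_gt0.
by apply/le_anti; rewrite le /=; have := le (hg_inv i); rewrite (ARN_involutive ARN_H).
Qed.

Lemma morph_mul_eqP (chi : hg_dual_space H) i j : algebra_morphism chi ->
  chi (hg_elt i) * chi (hg_elt j) = d i * d j <->
  (forall k, hg_N i j k != 0 -> chi (hg_elt k) = d k).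
Proof.
move=> chiM; rewrite (morph_N _ _ chiM) (morph_N _ _ FP_fp.1); split=> [E k Nk | E].
  apply: (mulfI Nk); apply: (normC_sum_upper _ E) => // l _.
  by rewrite normrM ger0_norm ?(ARN_ge0 ARN_H) // ler_wpM2l ?morph_le_d ?(ARN_ge0 ARN_H).
apply: eq_bigr => k _; have [->|/E-> //] := eqVneq (hg_N i j k) 0.
by rewrite !mul0r.
Qed.

(** Provides the closed set for [adjoint_subP] on the side of [H]. *)
Lemma ker_closed (chi : hg_dual_space H) : algebra_morphism chi ->
  mul_closed [set k | chi (hg_elt k) == d k]%SET.
Proof.
move=> chiM; split; first by rewrite inE -/(hg_one H) chiM.1 FP_fp.1.1.
move=> i j k; rewrite !inE => /eqP ei /eqP ej Nk; apply/eqP.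
by apply: (morph_mul_eqP i j chiM).1 Nk; rewrite ei ej.
Qed.

End FP.
End ARN.

(** * Characters as the dual basis *)

Section Duality.
Variables (C : numClosedFieldType) (H : hypergroup_data C).
Hypotheses (ARN_H : ARN_hypergroup H) (dual_H : dualizable H).
Local Notation I := 'I_(hg_rk H).+1.
Local Notation D := (dual_hypergroup H).
Local Notation mu := (tnth (dual_basis H)).
Implicit Types (i j k : I) (S T : {set I}).

(* The junk tuple of zeros in [dual_basis] would not be a basis. *)
Lemma dual_basisP : dual_basis_spec (dual_basis H).
Proof.
have := ARN_basis dual_H; rewrite /= /dual_basis.
case: classical_sets.xgetP => // _ /basis_free fr.
by have := free_not0 fr (mem_tnth ord0 _); rewrite tnth_mktuple eqxx.
Qed.

Lemma mu0 : mu ord0 = FPdim H. Proof. by case: dual_basisP. Qed.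

Lemma mu_morph j : algebra_morphism (mu j).
Proof. by case: dual_basisP => _ _ <-; apply: mem_tnth. Qed.

(** Existence comes from dualizability: the default value 0 is excluded since [FPdim H] is
    [mu ord0], a morphism, and so takes the value 1 at the unit. *)
Lemma FPdimP : is_FPdim (FPdim H).
Proof.
have := mu_morph ord0; rewrite mu0 /FPdim; case: classical_sets.xgetP => // _ [].
by rewrite zero_lfunE => /eqP; rewrite eq_sym oner_eq0.
Qed.

Lemma dual_invE j i : mu (dual_inv j) (hg_elt i) = mu j (hg_elt (hg_inv i)).
Proof.
rewrite /dual_inv; case: pickP => [k /forallP/(_ i)/eqP //| noinv].
(* The default [j] of [dual_inv] is never reached: [inv_form (mu j)] is a character, hence listed in
   the dual basis. *)
have /tnthP[k Ek] : inv_form (mu j) \in dual_basis H.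
  by case: dual_basisP => _ _ ->; apply: inv_form_morph (mu_morph j).
have /negP[] := negbT (noinv k); apply/forallP => l.
by rewrite -Ek inv_form_elt.
Qed.

Lemma dual_decomp (f : hg_dual_space H) v :
  f v = \sum_c hg_coef (H := D) c f * mu c v.
Proof.
have E : f = \sum_c hg_coef (H := D) c f *: mu c := hg_decomp dual_H f.
by rewrite {1}E sum_lfunE; apply: eq_bigr => c _; rewrite scale_lfunE.
Qed.

Lemma mu_mul a b i :
  mu a (hg_elt i) * mu b (hg_elt i) =
  hg_d i * \sum_c hg_N (H := D) a b c * mu c (hg_elt i).
Proof.
have di0 : hg_d i != 0 by rewrite gt_eqF // (d_gt0 FPdimP).
have := dual_mulE (mu a) (mu b) (ARN_basis ARN_H) di0.
rewrite !linearZ /= (dual_decomp (dual_mul _ _)) => E.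
(* Scaling in [C^o] is multiplication in [C]; restated this way, the equation is accessible to
   [field]. *)
have {}E : (hg_d i)^-1 * (\sum_c hg_N (H := D) a b c * mu c (hg_elt i)) =
  (hg_d i)^-1 * mu a (hg_elt i) * ((hg_d i)^-1 * mu b (hg_elt i)) := E.
by rewrite -[\sum_c _](mulVKf di0) E; field.
Qed.

(** Evaluation of [mu_mul] at the unit. The dual structure constants are thus convex weights. *)
Lemma dual_N_sum a b : \sum_c hg_N (H := D) a b c = 1.
Proof.
have mu1 j : mu j (hg_elt ord0) = 1 := (mu_morph j).1.
have := mu_mul a b ord0; rewrite !mu1 /hg_d -mu0 mu1 !mul1r => ->.
by apply: eq_bigr => c _; rewrite mu1 mulr1.
Qed.

(** Dual counterpart of [morph_mul_eqP]: after cancelling one factor d_i, a convex combination of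
    numbers of modulus at most d_i equals d_i. *)
Lemma dual_mul_eqP a b i :
  mu a (hg_elt i) * mu b (hg_elt i) = hg_d i * hg_d i <->
  (forall c, hg_N (H := D) a b c != 0 -> mu c (hg_elt i) = hg_d i).
Proof.
have d0 : hg_d i != 0 by rewrite gt_eqF // (d_gt0 FPdimP).
have dE : hg_d i = \sum_c hg_N (H := D) a b c * hg_d i.
  by rewrite -mulr_suml dual_N_sum mul1r.
rewrite mu_mul; split=> [/(mulfI d0) E c Nc | E].
  rewrite dE in E; apply: (mulfI Nc); apply: (normC_sum_upper _ E) => // l _.
  rewrite normrM ger0_norm ?(ARN_ge0 dual_H) // ler_wpM2l ?(ARN_ge0 dual_H) //.
  exact: morph_le_d FPdimP _ _ (mu_morph l).
congr (_ * _); rewrite [RHS]dE; apply: eq_bigr => c _.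
by have [->|/E-> //] := eqVneq (hg_N (H := D) a b c) 0; rewrite !mul0r.
Qed.

(** * Orthogonality and the adjoint series *)

Definition perp S : {set I} := [set j | [forall i in S, mu j (hg_elt i) == hg_d i]]%SET.

Lemma perpP S j : reflect (forall i, i \in S -> mu j (hg_elt i) = hg_d i) (j \in perp S).
Proof. by rewrite inE; apply: (iffP forall_inP) => E i iS; apply/eqP/E. Qed.

Lemma perp_closed S : mul_closed (H := D) (perp S).
Proof.
split=> [|a b c /perpP aS /perpP bS Nc]; apply/perpP => i iS; first by rewrite mu0.
by apply: (dual_mul_eqP a b i).1 Nc; rewrite aS ?bS.
Qed.

(* Both sides say that mu_j(x_i) mu_j(x_i^* ) = d_i^2 for all i in S, j in T. *)
Lemma adjoint_perp S T : adjoint (H := D) T \subset perp S = (T \subset perp (adjoint S)).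
Proof.
have key i j : (forall c, hg_N (H := D) j (hg_inv (h := D) j) c != 0 ->
      mu c (hg_elt i) = hg_d i) <->
    (forall k, hg_N i (hg_inv i) k != 0 -> mu j (hg_elt k) = hg_d k).
  rewrite -dual_mul_eqP -(morph_mul_eqP ARN_H FPdimP _ _ (mu_morph j)).
  by rewrite (dual_invE j) (d_inv ARN_H FPdimP).
apply/idP/idP => [/(adjoint_subP dual_H _ (perp_closed S)) TS | /subsetP TS].
  apply/subsetP => j jT; apply/perpP => k kS.
  have /subsetP/(_ k kS) : adjoint S \subset [set k | mu j (hg_elt k) == hg_d k]%SET.
    apply/(adjoint_subP ARN_H _ (ker_closed ARN_H FPdimP (mu_morph j))) => i l iS Nl.
    rewrite inE; apply/eqP; move: l Nl; apply/key => c Nc.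
    exact: (elimT (perpP S c) (TS j c jT Nc)).
  by rewrite inE => /eqP.
apply/(adjoint_subP dual_H _ (perp_closed S)) => j c jT Nc; apply/perpP => i iS.
move: c Nc; apply/key => k Nk.
by have /perpP := TS j jT; apply; apply: adjoint_N ARN_H _ _ _ iS Nk.
Qed.

Lemma iter_adjoint_perp n S T :
  iter n (@adjoint _ D) T \subset perp S = (T \subset perp (iter n (@adjoint _ H) S)).
(* [S] must vary: the outermost adjoint in the dual becomes the innermost one in [H]. *)
Proof. by elim: n S => [//|n IHn] S; rewrite iterS adjoint_perp IHn -iterSr. Qed.

(** A character agreeing with [FPdim H] on the basis equals it, and the dual basis has no
    repetition. *)
Lemma perpT : perp [set: I]%SET = [set ord0]%SET.
Proof.
apply/setP => j; rewrite in_set1; apply/perpP/eqP => [jT|-> i _]; last by rewrite mu0.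
have [_ Umu _] := dual_basisP; apply: (tuple_uniqP _ Umu); rewrite mu0; apply/lfunP => v.
rewrite (hg_decomp ARN_H v) !linear_sum; apply: eq_bigr => i _.
by rewrite !linearZ /= jT ?in_setT.
Qed.

(* The coordinate form of x_k lies in the span of the mu_j. *)
Lemma subset_perp S : ([set: I]%SET \subset perp S) = (S \subset [set ord0]%SET).
Proof.
apply/subsetP/subsetP => [TS k kS | S0 j _]; last first.
  apply/perpP => i /S0; rewrite inE => /eqP ->.
  by rewrite (mu_morph j).1 /hg_d FPdimP.1.1.
have muk (f : hg_dual_space H) : f (hg_elt k) = hg_d k * f (hg_one H).
  rewrite !(dual_decomp f) mulr_sumr; apply: eq_bigr => j _; rewrite (mu_morph j).1.
  by have /perpP -> // := TS j (in_setT j); rewrite mulr1 mulrC.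
rewrite inE eq_sym; have := muk (coord_form k).
rewrite !(coord_form_elt ARN_H) eqxx; case: eqP => // _ /eqP.
by rewrite mulr0 oner_eq0.
Qed.

(** With both starting sets full, [perpT] and [subset_perp] turn the two sides of
    [iter_adjoint_perp] into triviality of the two n-th terms. *)
Lemma adjoint_series_dual n :
  adjoint_series D n = [set ord0]%SET <-> adjoint_series H n = [set ord0]%SET.
Proof.
have := iter_adjoint_perp n [set: I]%SET [set: I]%SET; rewrite perpT subset_perp => E.
by split=> /eqP S1; apply/eqP; move: S1; rewrite (adjoint_series_eq1 ARN_H)
  (adjoint_series_eq1 dual_H) /adjoint_series E.
Qed.

End Duality.

Theorem theorem1p14 (R : realType) (H : hypergroup_data (complex R))
    (ARN_H : ARN_hypergroup H) (dual_H : dualizable H) :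
  (nilpotent_hypergroup H <-> nilpotent_hypergroup (dual_hypergroup H)) /\
  (nilpotent_hypergroup H ->
   exists c : nat, is_nilpotency_class H c /\
                   is_nilpotency_class (dual_hypergroup H) c).
Proof.
have dualE := adjoint_series_dual ARN_H dual_H.
split=> [|nilH]; first by split=> -[n /dualE]; exists n.
have exn : exists n, adjoint_series H n == [set ord0]%SET.
  by have [n /eqP] := nilH; exists n.
case: (ex_minnP exn) => c /eqP Hc cmin.
by exists c; split; split=> [|n]; rewrite ?dualE // => /eqP; apply: cmin.
Qed.
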